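(* Let a weight have anchor $\hat w$ in a cell with walls $\ell<\hat w<u$. Write $a=\hat w-\ell$ and $b=u-\hat w$ for its distances to the two walls, $W=a+b$ for the cell's fixed width, $d=a-b$ for its asymmetry and $r=\min(a,b)$ for the inradius about its current anchor. Let a bounded update move the weight to $w'=\hat w+r\,t$ with $|t|<1$, and fold $w'$ into the anchor for the next update. Then the surviving inradius is exactly $$r'=\min\big(a+rt,\;b-rt\big)=\frac W2-\frac{|d+2rt|}{2},\qquad\text{while}\qquad r=\frac W2-\frac{|d|}{2},$$ and three things follow. (i) $r'\ge r(1-|t|)$, with equality when the update moves toward the nearer wall and always when the cell is symmetric. (ii) A single fold can increase the room: moving toward the far wall recentres the anchor, and for $a=1$, $b=10$, $t=+\tfrac12$ the inradius goes from $1$ to $\tfrac32$. A lower bound on $r'$ therefore does not by itself make the room decay. (iii) If the sign of $t$ is symmetric, convexity of $|\cdot|$ gives $\mathbb E|d+2rt|\ge|d|$ and hence $$\mathbb E[r']\le r,$$ with equality exactly when $|d|\ge 2r|t|$ (when the update never changes which wall is nearer), and with the maximal contraction $\mathbb E[r']=r(1-|t|)$ at a symmetric cell. The room is therefore non-increasing in expectation under folding, and it contracts fastest where the anchor sits centred in its cell.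
   Context: A cell $[\ell,u]$ is the interval in which a quantized weight may move without changing its stored code. Its walls stay fixed. Folding means that the updated weight $w'$ becomes the new anchor inside the same cell, so the new distances to the walls are $a+rt$ and $b-rt$. The room of a weight is its inradius, the distance from the anchor to the nearer wall. The cell is symmetric when $d=0$. In (iii), $\mathbb E$ is expectation over the random update.
   Formalization: In (ii), ''moving toward the far wall recentres the anchor'' is proved for moves with r|t| < |d|, exactly the moves that reduce |d| and raise the inradius; a larger move overshoots, e.g. a=1, b=1.1, t=1/2 lowers the inradius from 1 to 0.6. *)

(* Defs.v *)
From mathcomp Require Import all_boot all_order all_algebra.
From mathcomp Require Import all_classical all_reals all_analysis.

Set Implicit Arguments.
Unset Strict Implicit.
Unset Printing Implicit Defensive.

Import Order.TTheory GRing.Theory Num.Theory.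
Import numFieldNormedType.Exports.

Local Open Scope ring_scope.

(* A cell [l, u] is given by its walls l and u; w is an anchor, l < w < u. *)
Definition lower_dist (R : realType) (l w : R) : R := w - l.

Definition upper_dist (R : realType) (u w : R) : R := u - w.

Definition asymmetry (R : realType) (l u w : R) : R :=
  lower_dist l w - upper_dist u w.

Definition inradius (R : realType) (l u w : R) : R :=
  Num.min (lower_dist l w) (upper_dist u w).

(* The update is measured in units of the current inradius; the walls are kept. *)
Definition fold_anchor (R : realType) (l u w t : R) : R :=
  w + inradius l u w * t.

Definition folded_inradius (R : realType) (l u w t : R) : R :=
  inradius l u (fold_anchor l u w t).

Definition toward_nearer_wall (R : realType) (l u w t : R) : Prop :=
  (lower_dist l w < upper_dist u w /\ t < 0) \/
  (upper_dist u w < lower_dist l w /\ 0 < t).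

Definition toward_far_wall (R : realType) (l u w t : R) : Prop :=
  (lower_dist l w < upper_dist u w /\ 0 < t) \/
  (upper_dist u w < lower_dist l w /\ t < 0).

(* Each wall that is nearest to w (both are, if w is centred) is still nearest
   after the fold; reaching the centre exactly does not count as a change. *)
Definition keeps_nearer_wall (R : realType) (l u w t : R) : Prop :=
  let w' := fold_anchor l u w t in
  (lower_dist l w <= upper_dist u w -> lower_dist l w' <= upper_dist u w') /\
  (upper_dist u w <= lower_dist l w -> upper_dist u w' <= lower_dist l w').

(* T and - T have the same law, i.e. given |T| the two signs are equally
   likely. *)
Definition sign_symmetric (R : realType) (disp : measure_display)
    (Omega : measurableType disp) (P : probability Omega R)
    (T : {RV P >-> R}) : Prop :=
  forall B : set R, measurable B ->
    P (T @^-1` B)%classic = P ((fun x => - T x) @^-1` B)%classic.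

(* Main.v *)
(* The exact formulas reduce everything to [d' = d + 2 r t].  For the expectation, a
   sign-symmetric update may be replaced by the average over [t] and [- t], and
   [|d + x| + |d - x| = 2 max(|d|, |x|)]: the averaged inradius is [r] minus the
   nonnegative loss [max(0, r|t| - |d|/2)].  This loss is at most [r|t|], equals
   [r|t|] when [d = 0], and vanishes exactly when [2r|t| <= |d|]; all the claims of
   (iii) are read off its expectation. *)
Require Import Defs.
From mathcomp Require Import all_boot all_order all_algebra.
From mathcomp Require Import all_classical all_reals all_analysis.
From mathcomp Require Import measurable_realfun.
From mathcomp Require Import ring lra.
Import Order.TTheory GRing.Theory Num.Theory.
Import numFieldNormedType.Exports.
Local Open Scope ring_scope.

Set Implicit Arguments.
Unset Strict Implicit.

(** * Deterministic geometry of one fold in a fixed cell *)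

Section Cell.
Variable R : realType.
Implicit Types l u w t : R.

(** A move by [r t] lengthens one wall distance and shortens the other by the same amount, hence the
    factor 2. *)
Lemma asymmetry_fold l u w t :
  asymmetry l u (fold_anchor l u w t) =
  asymmetry l u w + 2 * inradius l u w * t.
Proof. rewrite /asymmetry /lower_dist /upper_dist /fold_anchor; ring. Qed.

Lemma inradiusE l u w :
  inradius l u w = (u - l) / 2 - `|asymmetry l u w| / 2.
Proof.
rewrite /inradius /asymmetry /lower_dist /upper_dist.
case: (lerP (w - l) (u - w)); lra.
Qed.

Lemma folded_inradiusE l u w t :
  folded_inradius l u w t =
  (u - l) / 2 - `|asymmetry l u w + 2 * inradius l u w * t| / 2.
Proof. by rewrite /folded_inradius inradiusE asymmetry_fold. Qed.

Lemma inradius_gt0 l u w : l < w -> w < u -> 0 < inradius l u w.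
Proof.
by move=> lw wu; rewrite /inradius /lower_dist /upper_dist lt_min !subr_gt0 lw.
Qed.

Lemma inradius_midpoint l u : l < u -> inradius l u ((l + u) / 2) = (u - l) / 2.
Proof.
move=> lu; rewrite inradiusE (_ : asymmetry _ _ _ = 0) ?normr0 ?mul0r ?subr0//.
rewrite /asymmetry /lower_dist /upper_dist; lra.
Qed.

(** The move has length less than [r], which is at most the distance to either wall. *)
Lemma fold_anchor_in_cell l u w t :
  l < w -> w < u -> `|t| < 1 -> l < fold_anchor l u w t < u.
Proof.
move=> lw wu t1; have r0 := inradius_gt0 lw wu.
have /andP[] : - inradius l u w < inradius l u w * t < inradius l u w.
  by rewrite -ltr_norml normrM (gtr0_norm r0) gtr_pMr.
have : inradius l u w <= w - l by rewrite /inradius ge_min lexx.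
have : inradius l u w <= u - w by rewrite /inradius ge_min lexx orbT.
rewrite /fold_anchor => *; apply/andP; split; lra.
Qed.

(** This is the triangle inequality for [|d + 2rt|]. *)
Lemma folded_inradius_ge l u w t : l < w -> w < u ->
  inradius l u w * (1 - `|t|) <= folded_inradius l u w t.
Proof.
move=> lw wu; have r0 := inradius_gt0 lw wu.
have := ler_normD (asymmetry l u w) (2 * inradius l u w * t).
rewrite 2!normrM (gtr0_norm r0) (@ger0_norm _ 2)// folded_inradiusE.
have := inradiusE l u w; lra.
Qed.

(** Here [d] and [2rt] have the same sign, so the triangle inequality is an equality. *)
Lemma folded_inradius_toward_nearer l u w t : l < w -> w < u ->
  toward_nearer_wall l u w t ->
  folded_inradius l u w t = inradius l u w * (1 - `|t|).
Proof.
move=> lw wu; have r0 := inradius_gt0 lw wu.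
move=> h; rewrite folded_inradiusE mulrBr mulr1 {2}inradiusE.
case: h => -[ab t0].
- have rt0 : inradius l u w * t < 0 by rewrite pmulr_rlt0.
  rewrite (ltr0_norm t0) !ltr0_norm /asymmetry; lra.
- have rt0 : 0 < inradius l u w * t by rewrite mulr_gt0.
  rewrite (gtr0_norm t0) !gtr0_norm /asymmetry; lra.
Qed.

Lemma folded_inradius_symmetric l u w t : l < w -> w < u ->
  asymmetry l u w = 0 ->
  folded_inradius l u w t = inradius l u w * (1 - `|t|).
Proof.
move=> lw wu d0; have r0 := inradius_gt0 lw wu.
rewrite folded_inradiusE mulrBr mulr1 {2}inradiusE d0 add0r normr0.
rewrite 2!normrM (gtr0_norm r0) (@ger0_norm _ 2)//; lra.
Qed.

(** The shift [2rt] is opposite in sign to [d] and shorter than [2|d|], so any overshoot past the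
    centre stays below the initial asymmetry. *)
Lemma toward_far_norm_asymmetry l u w t : l < w -> w < u ->
  toward_far_wall l u w t -> inradius l u w * `|t| < `|asymmetry l u w| ->
  `|asymmetry l u w + 2 * inradius l u w * t| < `|asymmetry l u w|.
Proof.
move=> lw wu; have r0 := inradius_gt0 lw wu.
case=> -[ab t0].
- have d0 : asymmetry l u w < 0 by rewrite subr_lt0.
  have rt0 : 0 < inradius l u w * t by rewrite mulr_gt0.
  by rewrite (gtr0_norm t0) (ltr0_norm d0) ltr_norml => ?; apply/andP; split; lra.
- have d0 : 0 < asymmetry l u w by rewrite subr_gt0.
  have rt0 : inradius l u w * t < 0 by rewrite pmulr_rlt0.
  by rewrite (ltr0_norm t0) (gtr0_norm d0) ltr_norml => ?; apply/andP; split; lra.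
Qed.

Lemma keeps_nearer_wallE l u w t : keeps_nearer_wall l u w t <->
  let d := asymmetry l u w in let x := 2 * inradius l u w * t in
  (d <= 0 -> d + x <= 0) /\ (0 <= d -> 0 <= d + x).
Proof.
rewrite /= -asymmetry_fold /keeps_nearer_wall /asymmetry.
by rewrite !subr_le0 !subr_ge0.
Qed.

(** An update away from the centre never changes the nearer wall, so both signs are required: one of
    them moves [d] toward 0 by [2r|t|], and it does not cross 0 exactly when this is at most [|d|].
    If [d = 0], both clauses apply and force the shift to vanish. *)
Lemma keeps_nearer_wall_pm l u w t : l < w -> w < u ->
  2 * inradius l u w * `|t| <= `|asymmetry l u w| <->
  keeps_nearer_wall l u w t /\ keeps_nearer_wall l u w (- t).
Proof.
move=> lw wu; have r0 := inradius_gt0 lw wu.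
have -> : 2 * inradius l u w * `|t| = `|2 * inradius l u w * t|.
  by rewrite 2!normrM (gtr0_norm r0) (@ger0_norm _ 2).
rewrite !keeps_nearer_wallE mulrN.
set d := asymmetry l u w; set x := 2 * _ * t; rewrite ler_norml /=.
split=> [/andP[]|].
  case: (ltrgt0P d) => [d0|d0|->] h1 h2; split; split => // _; lra.
case: (ltrgt0P d) => ? [[h1 h2] [h3 h4]]; apply/andP; split.
- by have := h4 isT; lra.
- by have := h2 isT; lra.
- by have := h1 isT; lra.
- by have := h3 isT; lra.
- by have := h2 isT; lra.
- by have := h4 isT; lra.
Qed.

(* The drop of the inradius averaged over the two updates [t] and [- t]. *)
Definition fold_loss l u w t : R :=
  Num.max 0 (inradius l u w * `|t| - `|asymmetry l u w| / 2).

Lemma folded_inradius_pm l u w t : l < w -> w < u ->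
  folded_inradius l u w t + folded_inradius l u w (- t) =
  2 * inradius l u w - 2 * fold_loss l u w t.
Proof.
move=> lw wu; have r0 := inradius_gt0 lw wu.
rewrite !folded_inradiusE /fold_loss mulrN.
have -> : inradius l u w * `|t| = `|2 * inradius l u w * t| / 2.
  by rewrite 2!normrM (gtr0_norm r0) (@ger0_norm _ 2)//; lra.
have := inradiusE l u w.
(* Only [d] and the shift [x] remain; both sides are piecewise linear in them, with pieces cut out
   by the signs below. *)
move: (2 * _ * t) (asymmetry l u w) => x d ->.
case: (ger0P d) => ?; case: (ger0P x) => ?;
case: (ger0P (d + x)) => ?; case: (ger0P (d - x)) => ?;
case: (leP 0); lra.
Qed.

Lemma fold_loss_ge0 l u w t : 0 <= fold_loss l u w t.
Proof. by rewrite /fold_loss le_max lexx. Qed.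

Lemma fold_loss_le l u w t : l < w -> w < u ->
  fold_loss l u w t <= inradius l u w * `|t|.
Proof.
move=> lw wu; have r0 := inradius_gt0 lw wu.
rewrite /fold_loss ge_max mulr_ge0 ?(ltW r0)//=.
have := normr_ge0 (asymmetry l u w); lra.
Qed.

Lemma fold_loss_eq0 l u w t : fold_loss l u w t = 0 <->
  2 * inradius l u w * `|t| <= `|asymmetry l u w|.
Proof.
rewrite /fold_loss; case: (leP 0) => ?; split=> ?; lra.
Qed.

End Cell.

(** * Integrability and the law of a sign-symmetric update *)

Section Symm.
Variables (R : realType) (disp : measure_display).
Variables (Omega : measurableType disp) (P : probability Omega R).

Lemma bounded_Lfun1 (X : Omega -> R) (M : R) :
  measurable_fun setT X -> (forall x, `|X x| <= M) -> X \in Lfun P 1.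
Proof.
move=> mX XM; apply/Lfun1_integrable.
apply: measurable_bounded_integrable => //.
  exact: fin_num_fun_lty.
exists M; split; first exact: num_real.
by move=> N MN x _; apply: le_trans (XM x) (ltW MN).
Qed.

Variables (T : {RV P >-> R}).
Hypothesis sT : sign_symmetric T.

(** By change of variables, both expectations are integrals of [f] against the common law of [T] and
    [- T]. *)
Lemma sign_symmetric_expectation (f : R -> R) : measurable_fun setT f ->
  (fun x => f (T x)) \in Lfun P 1 -> (fun x => f (- T x)) \in Lfun P 1 ->
  ('E_P[fun x => f (T x)] = 'E_P[fun x => f (- T x)%R])%E.
Proof.
move=> mf /Lfun1_integrable iT /Lfun1_integrable iNT; rewrite unlock.
have mNT : measurable_fun setT (fun x => - T x) by exact: measurableT_comp.
pose TN : {RV P >-> R} := mfun_Sub (mem_set mNT).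
have mEf : measurable_fun setT (EFin \o f) by exact/measurable_EFinP.
have <- := @integral_distribution _ _ _ _ _ P T (EFin \o f) mEf iT.
have <- := @integral_distribution _ _ _ _ _ P TN (EFin \o f) mEf iNT.
by apply: eq_measure_integral => B mB _; exact: sT.
Qed.

(** The exceptional events are the preimages of the complement of [B] under [T] and [- T], which
    have equal probability. *)
Lemma sign_symmetric_ae (B : set R) : measurable B ->
  {ae P, forall x, B (T x)} -> {ae P, forall x, B (- T x)}.
Proof.
move=> mB.
have mC : measurable (~` B)%classic by exact: measurableC.
have mT : measurable_fun setT T by [].
have mNT : measurable_fun setT (fun x => - T x) by exact: measurableT_comp.
have h1 : measurable (T @^-1` (~` B))%classic.
  by rewrite -[X in measurable X]setTI; exact: mT.
have h2 : measurable ((fun x => - T x) @^-1` (~` B))%classic.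
  by rewrite -[X in measurable X]setTI; exact: mNT.
move=> /(negligibleP P h1) h; apply/(negligibleP P h2).
exact: etrans (esym (sT mC)) h.
Qed.

(** Since [P] has total mass 1, a property that holds almost everywhere holds at some point. This
    removes the quantifier when [|T|] is constant. *)
Lemma ae_cst (Q : Prop) : {ae P, forall x, Q} <-> Q.
Proof.
split=> [|q]; last exact: aeW.
have PF : ProperFilter (almost_everywhere P).
  apply: ae_properfilter_algebraOfSetsType => /=.
  by rewrite (probability_setT P) lte01.
by move=> h; have [x] := @filter_ex _ _ PF _ h.
Qed.

End Symm.

(** * Measurability of the functions and events of a fold *)

Section Measurability.
Variables (R : realType) (l u w : R).

Lemma measurable_folded_inradius : measurable_fun setT (folded_inradius l u w).
Proof.
apply: measurable_minr; rewrite /lower_dist /upper_dist /fold_anchor.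
  by apply: measurable_funB => //; apply: measurable_funD.
by apply: measurable_funB => //; apply: measurable_funD.
Qed.

Lemma measurable_fold_loss : measurable_fun setT (fold_loss l u w).
Proof.
apply: measurable_maxr => //; apply: measurable_funB => //.
by apply: measurable_funM => //; exact: measurableT_comp.
Qed.

(** The guards do not depend on [t]: each clause is either vacuous or the preimage of a closed
    half-line under an affine map. *)
Lemma measurable_keeps_nearer_wall :
  measurable ([set t | keeps_nearer_wall l u w t])%classic.
Proof.
set d := asymmetry l u w; set r := inradius l u w.
have mf : measurable_fun setT (fun t => d + 2 * r * t).
  exact: measurable_funD.
rewrite (_ : mkset _ =
    ([set t | d <= 0 -> (d + 2 * r * t <= 0)] `&`
     [set t | 0 <= d -> (0 <= d + 2 * r * t)])%classic); last first.
  by apply/seteqP; split=> t /keeps_nearer_wallE.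
apply: measurableI.
- have [d0|d0] := boolP (d <= 0).
    rewrite (_ : mkset _ = ((fun t => d + 2 * r * t) @^-1` `]-oo, 0%R])%classic).
      by rewrite -[X in measurable X]setTI; exact: mf.
    by apply/seteqP; split=> t /=; rewrite in_itv/=; [exact|move=> ? _].
  rewrite (_ : mkset _ = setT) //.
  by apply/seteqP; split=> t //= _.
- have [d0|d0] := boolP (0 <= d).
    rewrite (_ : mkset _ = ((fun t => d + 2 * r * t) @^-1` `[0%R, +oo[)%classic).
      by rewrite -[X in measurable X]setTI; exact: mf.
    by apply/seteqP; split=> t /=; rewrite in_itv/= andbT; [exact|move=> ? _].
  rewrite (_ : mkset _ = setT) //.
  by apply/seteqP; split=> t //= _.
Qed.

End Measurability.

(** * Expectations under a bounded sign-symmetric update *)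

Section RandomFold.
Variables (R : realType) (disp : measure_display).
Variables (Omega : measurableType disp) (P : probability Omega R).
Variable T : {RV P >-> R}.
Hypothesis T1 : forall x, `|T x| < 1.
Hypothesis sT : sign_symmetric T.

Lemma Lfun1_norm : (fun x => `|T x|) \in Lfun P 1.
Proof.
apply: (@bounded_Lfun1 _ _ _ _ _ 1) => [|x]; last by rewrite normr_id ltW.
exact: measurableT_comp.
Qed.

Variables l u w : R.
Hypotheses (lw : l < w) (wu : w < u).
Let r0 : 0 < inradius l u w := inradius_gt0 lw wu.

Lemma Lfun1_fold_loss : (fun x => fold_loss l u w (T x)) \in Lfun P 1.
Proof.
apply: (@bounded_Lfun1 _ _ _ _ _ (inradius l u w)) => [|x].
  by apply: measurableT_comp => //; exact: measurable_fold_loss.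
rewrite ger0_norm ?fold_loss_ge0// (le_trans (fold_loss_le _ _ _))//.
by rewrite ger_pMr// ltW.
Qed.

Lemma folded_inradius_ge0 x : 0 <= folded_inradius l u w (T x).
Proof.
apply: le_trans (folded_inradius_ge _ lw wu).
by rewrite mulr_ge0 ?(ltW r0)// subr_ge0 ltW.
Qed.

Lemma folded_inradius_le_half_width t : folded_inradius l u w t <= (u - l) / 2.
Proof. by rewrite folded_inradiusE gerBl divr_ge0. Qed.

Lemma Lfun1_folded_inradius :
  (fun x => folded_inradius l u w (T x)) \in Lfun P 1.
Proof.
apply: (@bounded_Lfun1 _ _ _ _ _ ((u - l) / 2)) => [|x].
  by apply: measurableT_comp => //; exact: measurable_folded_inradius.
by rewrite ger0_norm ?folded_inradius_le_half_width// folded_inradius_ge0.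
Qed.

Lemma expectation_folded_inradius :
  ('E_P[fun x => folded_inradius l u w (T x)] =
   (inradius l u w)%:E - 'E_P[fun x => fold_loss l u w (T x)])%E.
Proof.
have LF := Lfun1_folded_inradius; have LL := Lfun1_fold_loss.
(* The averaging identity [folded_inradius_pm] solved for the term at [- T]. *)
have gE : (fun x => folded_inradius l u w (- T x)) =
    cst (2 * inradius l u w) \- 2 \o* (fun x => fold_loss l u w (T x))
    \- (fun x => folded_inradius l u w (T x)).
  by apply/funext => x /=; have := folded_inradius_pm (T x) lw wu; lra.
have L2 : 2 \o* (fun x => fold_loss l u w (T x)) \in Lfun P 1.
  exact: Lfun_scale.
have LC : cst (2 * inradius l u w) \in Lfun P 1 by exact: Lfun_cst.
have LD : (fun x => folded_inradius l u w (- T x)) \in Lfun P 1.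
  by rewrite gE !rpredB.
have := sign_symmetric_expectation sT (measurable_folded_inradius l u w) LF LD.
rewrite gE !expectationB ?rpredB// expectation_cst expectationZl//.
(* With [F] the expected inradius and [L] the expected loss, both finite, symmetry gives the real
   equation [F = 2r - 2L - F]. *)
rewrite -(fineK (expectation_fin_num LF)) -(fineK (expectation_fin_num LL)).
by rewrite -EFinM -!EFinB => -[] h; congr EFin; lra.
Qed.

Lemma expectation_fold_loss_ge0 :
  (0 <= 'E_P[fun x => fold_loss l u w (T x)])%E.
Proof. by apply: expectation_ge0 => x; exact: fold_loss_ge0. Qed.

Lemma expectation_fold_loss_le :
  ('E_P[fun x => fold_loss l u w (T x)] <=
   (inradius l u w)%:E * 'E_P[fun x => `|T x|%R])%E.
Proof.
rewrite -expectationZl; last exact: Lfun1_norm.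
apply: expectation_le.
- by apply: measurableT_comp => //; exact: measurable_fold_loss.
- by apply: measurable_funM => //; exact: measurableT_comp.
- by move=> x; exact: fold_loss_ge0.
- by move=> x; rewrite mulr_ge0 ?(ltW r0).
- by apply: aeW => x /=; rewrite mulrC fold_loss_le.
Qed.

Lemma expectation_fold_loss_symmetric : asymmetry l u w = 0 ->
  ('E_P[fun x => fold_loss l u w (T x)] =
   (inradius l u w)%:E * 'E_P[fun x => `|T x|%R])%E.
Proof.
move=> d0; rewrite -expectationZl; last exact: Lfun1_norm.
congr expectation; apply/funext => x /=.
rewrite /fold_loss d0 normr0 mul0r subr0 mulrC; apply/max_idPr.
by rewrite mulr_ge0 ?(ltW r0).
Qed.

(** The loss is nonnegative, so its integral vanishes only if it is zero almost everywhere. *)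
Lemma expectation_fold_loss_eq0 :
  ('E_P[fun x => fold_loss l u w (T x)] = 0)%E <->
  {ae P, forall x, 2 * inradius l u w * `|T x| <= `|asymmetry l u w|}.
Proof.
have mL : measurable_fun setT (fun x => (fold_loss l u w (T x))%:E).
  apply/measurable_EFinP; apply: measurableT_comp => //.
  exact: measurable_fold_loss.
have aeE : ae_eq P setT (fun x => (fold_loss l u w (T x))%:E) (cst 0%E) <->
    {ae P, forall x, 2 * inradius l u w * `|T x| <= `|asymmetry l u w|}.
  split; apply: filterS => x /=.
    by move=> /(_ I) [] /fold_loss_eq0.
  by move=> h _; congr EFin; apply/fold_loss_eq0.
rewrite -aeE -ae_eq_integral_abs// unlock.
by under [in X in _ <-> X]eq_integral do
  rewrite gee0_abs ?lee_fin ?fold_loss_ge0//.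
Qed.

(** Since [|d + 2rT|] is the affine function [W - 2r'] of the folded inradius, its expectation
    follows by linearity. *)
Lemma expectation_abs_asymmetry :
  ('E_P[fun x => `|asymmetry l u w + 2 * inradius l u w * T x|%R] =
   (`|asymmetry l u w|)%:E + 2%:E * 'E_P[fun x => fold_loss l u w (T x)])%E.
Proof.
have LF := Lfun1_folded_inradius; have LL := Lfun1_fold_loss.
have -> : (fun x => `|asymmetry l u w + 2 * inradius l u w * T x|%R) =
    cst (u - l) \- 2 \o* (fun x => folded_inradius l u w (T x)).
  by apply/funext => x /=; rewrite folded_inradiusE; lra.
rewrite expectationB ?Lfun_cst ?Lfun_scale//.
rewrite expectation_cst expectationZl// expectation_folded_inradius.
rewrite -(fineK (expectation_fin_num LL)); move: (fine _) => L.
have h : u - l - 2 * (inradius l u w - L) = `|asymmetry l u w| + 2 * L.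
  by rewrite inradiusE; lra.
(* Operations on finite extended reals compute to the real ones, so the real identity suffices by
   conversion. *)
exact (f_equal (@EFin R) h).
Qed.

(** The pointwise criterion involves both [T] and [- T]; sign symmetry supplies the condition at
    [- T]. *)
Lemma ae_keeps_nearer_wall :
  {ae P, forall x, 2 * inradius l u w * `|T x| <= `|asymmetry l u w|} <->
  {ae P, forall x, keeps_nearer_wall l u w (T x)}.
Proof.
split=> [|h].
  by apply: filterS => x /keeps_nearer_wall_pm[].
have hN := sign_symmetric_ae sT (@measurable_keeps_nearer_wall R l u w) h.
apply: filterS2 h hN => x ? ?; exact/keeps_nearer_wall_pm.
Qed.

End RandomFold.

(** * Assembly of the three claims *)

Theorem proposition6 (R : realType) :
  (* the exact formulas and (i) *)
  (forall l w u : R, l < w -> w < u ->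
    let a := lower_dist l w in
    let b := upper_dist u w in
    let W := a + b in
    let d := asymmetry l u w in
    let r := inradius l u w in
    r = W / 2 - `|d| / 2 /\
    forall t : R, `|t| < 1 ->
      let w' := fold_anchor l u w t in
      let r' := folded_inradius l u w t in
      [/\ l < w' < u,
          r' = Num.min (a + r * t) (b - r * t),
          r' = W / 2 - `|d + 2 * r * t| / 2,
          r * (1 - `|t|) <= r' &
          (toward_nearer_wall l u w t -> r' = r * (1 - `|t|)) /\
          (d = 0 -> r' = r * (1 - `|t|))])
  /\
  (* (ii) *)
  [/\ forall l w u t : R, l < w -> w < u -> `|t| < 1 ->
        let d := asymmetry l u w in
        let r := inradius l u w in
        toward_far_wall l u w t -> r * `|t| < `|d| ->
        `|asymmetry l u (fold_anchor l u w t)| < `|d| /\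
        r < folded_inradius l u w t,
      forall l w u : R, lower_dist l w = 1 -> upper_dist u w = 10 ->
        [/\ toward_far_wall l u w (1 / 2),
            inradius l u w = 1 &
            folded_inradius l u w (1 / 2) = 3 / 2] &
      ~ (forall l w u t : R, l < w -> w < u -> `|t| < 1 ->
           inradius l u w * (1 - `|t|) <= folded_inradius l u w t ->
           folded_inradius l u w t <= inradius l u w)]
  /\
  (* (iii) *)
  (forall l w u : R, l < w -> w < u ->
    let d := asymmetry l u w in
    let r := inradius l u w in
    let r' := folded_inradius l u w in
    let c := (l + u) / 2 in
    (forall t : R, `|t| < 1 ->
       (2 * r * `|t| <= `|d| <->
        keeps_nearer_wall l u w t /\ keeps_nearer_wall l u w (- t))) /\
    forall (disp : measure_display) (Omega : measurableType disp)
           (P : probability Omega R) (T : {RV P >-> R}),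
      (forall x, `|T x| < 1) -> sign_symmetric T ->
      let Er' := ('E_P[fun x => r' (T x)])%E in
      let Eabs := ('E_P[fun x => `|T x|%R])%E in
      (`|d|%:E <= 'E_P[fun x => `|d + 2 * r * T x|%R])%E /\
      (Er' <= r%:E)%E /\
      (Er' = r%:E <-> {ae P, forall x, 2 * r * `|T x| <= `|d|}) /\
      ({ae P, forall x, 2 * r * `|T x| <= `|d|} <->
       {ae P, forall x, keeps_nearer_wall l u w (T x)}) /\
      (r%:E * (1 - Eabs) <= Er')%E /\
      (d = 0 -> Er' = (r%:E * (1 - Eabs))%E) /\
      (* an update of fixed size with a random sign *)
      (forall tau : R, (forall x, `|T x| = tau) ->
         (Er' = r%:E <-> 2 * r * tau <= `|d|) /\
         ((r * (1 - tau))%:E <= Er')%E /\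
         (d = 0 -> Er' = (r * (1 - tau))%:E)) /\
      (* the centred anchor c of the same cell loses the most room, both in
         absolute terms and relatively to the current room *)
      (r%:E - Er' <= (inradius l u c)%:E
          - 'E_P[fun x => folded_inradius l u c (T x)])%E /\
      (((inradius l u c)^-1)%:E * 'E_P[fun x => folded_inradius l u c (T x)]
          <= (r^-1)%:E * Er')%E).
Proof.
split; [|split].
- move=> l w u lw wu /=; have WE : lower_dist l w + upper_dist u w = u - l.
    by rewrite /lower_dist /upper_dist; ring.
  rewrite WE -inradiusE; split=> // t t1; split.
  + exact: fold_anchor_in_cell.
  + rewrite /folded_inradius {1}/inradius /fold_anchor /lower_dist /upper_dist.
    by congr Num.min; ring.
  + exact: folded_inradiusE.
  + exact: folded_inradius_ge.
  + split; first exact: folded_inradius_toward_nearer.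
    exact: folded_inradius_symmetric.
- have example (l w u : R) : lower_dist l w = 1 -> upper_dist u w = 10 ->
      [/\ toward_far_wall l u w (1 / 2), inradius l u w = 1 &
          folded_inradius l u w (1 / 2) = 3 / 2].
    move=> a1 b10.
    have r1 : inradius l u w = 1.
      by rewrite /inradius a1 b10; apply/min_idPl; lra.
    split=> //; first by left; rewrite a1 b10; split; lra.
    rewrite folded_inradiusE r1 /asymmetry a1 b10 ltr0_norm; last lra.
    by move: a1 b10; rewrite /lower_dist /upper_dist; lra.
  split=> //.
  + move=> l w u t lw wu t1 d r far rtd.
    have dd := toward_far_norm_asymmetry lw wu far rtd.
    rewrite asymmetry_fold; split=> //.
    (* At fixed width, a smaller asymmetry means a larger inradius. *)
    by rewrite folded_inradiusE /r [ltLHS]inradiusE; move: dd; rewrite /d; lra.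
  (* The cell [[0, 11]] with anchor 1 realises [a = 1], [b = 10]; the refuted claim would give
     [3 / 2 <= 1]. *)
  + have [||_ r1 r'1] := example 0 1 11; rewrite /lower_dist /upper_dist; try lra.
    move=> /(_ 0 1 11 (1 / 2)); rewrite r1 r'1.
    rewrite ger0_norm; last lra.
    by move=> h; have := h _ _ _ _; lra.
- move=> l w u lw wu d r r' c; split=> [t _|]; first exact: keeps_nearer_wall_pm.
  move=> disp Omega P T T1 sT Er' Eabs.
  have r0 : 0 < r := inradius_gt0 lw wu.
  have rE : r = (u - l) / 2 - `|d| / 2 := inradiusE l u w.
  have lc : l < c by rewrite /c; lra.
  have cu : c < u by rewrite /c; lra.
  have rcE : inradius l u c = (u - l) / 2 by apply: inradius_midpoint; lra.
  have dc : asymmetry l u c = 0.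
    by rewrite /asymmetry /lower_dist /upper_dist /c; lra.
  have Er'E := expectation_folded_inradius T1 sT lw wu.
  have EcE := expectation_folded_inradius T1 sT lc cu.
  rewrite (expectation_fold_loss_symmetric T1 lc cu dc) in EcE.
  have L0 := expectation_fold_loss_ge0 T l u w.
  have LA := expectation_fold_loss_le T1 lw wu.
  have Leq0 := expectation_fold_loss_eq0 T l u w.
  have Lsym := expectation_fold_loss_symmetric T1 lw wu.
  have EdE := expectation_abs_asymmetry T1 sT lw wu.
  have LT := Lfun1_norm T1.
  have LL := Lfun1_fold_loss T1 lw wu.
  have Etau (tau : R) : (forall x, `|T x| = tau) -> Eabs = tau%:E.
    move=> Ttau; rewrite -(expectation_cst P tau).
    by congr expectation; apply/funext.
  rewrite -/Er' -/Eabs -/r -/d -/r' rcE in Er'E EcE LA Leq0 Lsym EdE Etau *.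
  have Eabs_fin : (fine Eabs)%:E = Eabs := fineK (expectation_fin_num LT).
  have L_fin := fineK (expectation_fin_num LL).
  (* All expectations are finite: [A] will stand for that of [|T|] and [L] for the expected loss,
     and the facts about them become real (in)equalities. *)
  rewrite -Eabs_fin -L_fin in Er'E EcE L0 LA Leq0 Lsym EdE Etau *.
  move: (fine Eabs) (fine _) Er'E EcE L0 LA Leq0 Lsym EdE Etau.
  move=> A L Er'E EcE L0 LA Leq0 Lsym EdE Etau.
  have {}L0 : 0 <= L := L0.
  have {}LA : L <= r * A := LA.
  have {}Er'E : Er' = (r - L)%:E := Er'E.
  have {}Leq0 : L = 0 <-> {ae P, forall x, 2 * r * `|T x| <= `|d|}.
    by rewrite -Leq0; split=> [->|[]].
  have {}Lsym : d = 0 -> L = r * A by case/Lsym.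
  have Eeq : Er' = r%:E <-> L = 0.
    by rewrite Er'E; split=> [[]|->]; rewrite ?subr0//; lra.
  have Ege : (r%:E * (1 - A%:E) <= Er')%E.
    have h : r * (1 - A) <= r - L by lra.
    rewrite Er'E; exact: h.
  have Esym : d = 0 -> Er' = (r * (1 - A))%:E.
    by move=> /Lsym LrA; rewrite Er'E LrA; congr EFin; ring.
  split.
    have h : `|d| <= `|d| + 2 * L by lra.
    rewrite EdE; exact: h.
  split; first by rewrite Er'E lee_fin gerBl.
  split; first by rewrite Eeq.
  split; first exact: ae_keeps_nearer_wall.
  split=> //; split=> //; split.
    move=> tau Ttau; have [Atau] := Etau _ Ttau.
    split; last by rewrite -Atau.
    (* The size being fixed, the almost sure condition is a constant proposition. *)
    rewrite Eeq Leq0 -(ae_cst P (2 * r * tau <= `|d|)).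
    by split; apply: filterS => x; rewrite Ttau.
  rewrite EcE Er'E; split.
    (* The centred loss is [W/2 * A], and [L <= r * A <= W/2 * A] because [r <= W/2]; [A >= 0]
       follows from [0 <= L <= r * A]. *)
    have h : r - (r - L) <= (u - l) / 2 - ((u - l) / 2 - (u - l) / 2 * A).
      have A0 : 0 <= A by rewrite -(pmulr_rge0 _ r0); lra.
      have : r * A <= (u - l) / 2 * A.
        by rewrite ler_wpM2r// rE gerBl divr_ge0.
      lra.
    exact: h.
  (* The centred ratio is [1 - A], the other one is [1 - L / r], and [L <= r * A]. *)
  have h : ((u - l) / 2)^-1 * ((u - l) / 2 - (u - l) / 2 * A) <= r^-1 * (r - L).
    have ul0 : u - l != 0 by rewrite subr_eq0 gt_eqF// (lt_trans lw).
    rewrite (_ : _ * (_ - _ * A) = 1 - A); last by field.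
    by rewrite mulrC ler_pdivlMr//; lra.
  exact: h.
Qed.
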